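(* Let $m > n \geq 2$ be integers. If $S=\{v_1,\dots,v_m\}$ is a generic configuration of $m$ points on the sphere $S^{n-1}\subset\mathbb{R}^n$, then $S$ is determined up to orthogonal transformation from the set of unlabeled distances $\{|v_i - v_j|\}_{i<j}$. Explicitly: there is a non-empty Zariski open subset $U\subset (S^{n-1})^m$ such that for every $(v_1,\dots,v_m)\in U$, if $w_1,\dots,w_m\in S^{n-1}$ satisfy $\{|w_i-w_j| : i<j\} = \{|v_i-v_j| : i<j\}$, then there is $g\in \mathrm{O}(n)$ with $\{w_1,\dots,w_m\} = \{g v_1,\dots, g v_m\}$.
   Context: $S^{n-1}$ is the unit sphere in $\mathbb{R}^n$ and $|\cdot|$ is the Euclidean norm. ''Unlabeled'' means that one is given only the collection of distances, not which pair of points each distance comes from. $(S^{n-1})^m$ is regarded as a real algebraic variety with its Zariski topology; ''generic'' means belonging to some non-empty Zariski open subset. *)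

(* Defs.v *)
From mathcomp Require Import all_boot all_order all_algebra.
From mathcomp Require Import mpoly.
From mathcomp Require Import boolp classical_sets reals.

Set Implicit Arguments.
Unset Strict Implicit.
Unset Printing Implicit Defensive.

Import Order.TTheory GRing.Theory Num.Theory.
Local Open Scope ring_scope.
Local Open Scope classical_set_scope.

(* The norm [`|x|] that MathComp-Analysis puts on matrices is the sup norm,
   hence this separate Euclidean norm. *)
Definition enorm (R : realType) (n : nat) (x : 'cV[R]_n) : R :=
  Num.sqrt (\sum_(k < n) x k 0 ^+ 2).

(* With [n] the dimension of the ambient space, this is S^(n-1). *)
Definition unit_sphere (R : realType) (n : nat) : set 'cV[R]_n :=
  [set x | enorm x = 1].

Definition orthogonal_mx (R : realType) (n : nat) : set 'M[R]_n :=
  [set g | g^T *m g = 1%:M].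

Definition sphere_configs (R : realType) (m n : nat) : set ('I_m -> 'cV[R]_n) :=
  [set v | forall i, unit_sphere (v i)].

(* The m * n coordinates of a configuration, listed row by row: the variable of
   index [mxvec_index i k] is the k-th coordinate of the i-th point. *)
Definition coords (R : realType) (m n : nat) (v : 'I_m -> 'cV[R]_n) :
    'I_(m * n) -> R :=
  mxvec (\matrix_(i < m, k < n) v i k 0) 0.

Definition zariski_closed (R : realType) (m n : nat)
    (Z : set ('I_m -> 'cV[R]_n)) : Prop :=
  exists I : set {mpoly R[m * n]},
    Z = [set v | forall p, I p -> p.@[coords v] = 0].

(* Openness in the subspace topology that the Zariski topology of the ambient
   affine space (R^n)^m induces on [X]. *)
Definition zariski_open_in (R : realType) (m n : nat)
    (X U : set ('I_m -> 'cV[R]_n)) : Prop :=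
  exists2 Z : set ('I_m -> 'cV[R]_n), zariski_closed Z & U = X `\` Z.

(* A set and not a multiset: a repeated distance is recorded only once. *)
Definition unlabeled_distances (R : realType) (m n : nat)
    (v : 'I_m -> 'cV[R]_n) : set R :=
  [set d | exists i j : 'I_m, (i < j)%N /\ d = enorm (v i - v j)].

(* Main.v *)
Require Import Defs.
From mathcomp Require Import all_boot all_order all_algebra.
From mathcomp Require Import mpoly.
From mathcomp Require Import boolp classical_sets reals.
Import fintype boot.finset.
From mathcomp Require Import perm fingroup.
From mathcomp Require Import zify ring lra.

Set Implicit Arguments.
Unset Strict Implicit.
Unset Printing Implicit Defensive.

Import Order.TTheory GRing.Theory Num.Theory.
Local Open Scope ring_scope.

(** Inner products and distances determine each other on the sphere. When the
    distances of [v] are pairwise different, the equality of the two distance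
    sets therefore gives a permutation [s] of the two-element subsets of the
    index set, the edges of the complete graph, such that
    <w_i, w_j> = <v_k, v_l> with {k, l} = [s {i, j}]. The proof shows that, for
    generic [v], such an [s] comes from a permutation [p] of the points. Then
    the configurations [w] and [v \o p] have the same Gram matrix, and when [v]
    spans the space this makes them differ by an orthogonal transformation
    ([gram_eq_orthogonal]).

    The constraint on [s] is that any n+1 of the vectors w_i are linearly
    dependent, so the (n+1)-minors of the matrix with unit diagonal and entries
    <v_k, v_l> off the diagonal, {k, l} = [s {i, j}], vanish at [v]. Only
    finitely many polynomials in the coordinates arise in this way, over all
    possible [s]. The open set is where none of them vanishes, except those that
    vanish on the whole product of spheres. Hence for [v] in the open set all
    these minors vanish identically, and may be evaluated at any configuration.
    The configurations used are those in which every point is a vector of the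
    standard basis: they are the colourings [c] of the indices by n colours, and
    the inner product of an edge is 1 if the edge is monochromatic and 0
    otherwise.

    Now suppose that [s] does not come from a permutation of the points. Then
    either two adjacent edges have disjoint images, or three edges at a common
    vertex have the edges of a triangle as images
    ([edge_map_from_vertex_map]). Choose n+1 indices containing the two adjacent
    edges, or two of the three edges. Contract the two disjoint edges, or the
    triangle, to points: the remaining images of edges between chosen indices
    are fewer than binomial(n+1, 2), and a graph with so few edges has an
    n-colouring ([few_edges_colorable]). With respect to it, the monochromatic
    images come exactly from edges at one vertex, at least two of them, and the
    minor is the determinant of the identity plus the adjacency matrix of a star
    with d >= 2 leaves, which is 1 - d and not 0 ([star_mx_unit]).

    The open set is not empty because the product of spheres is irreducible.
    Concretely, [line_reflection] parametrizes the sphere by rational functions,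
    and along a line in the space of parameters a polynomial in the coordinates
    becomes a rational function of one variable, which has finitely many zeros
    unless it is zero; so two polynomials that are not identically zero on the
    product of spheres have a common point of nonvanishing ([generic_polyM]). *)

(** * Colourings of graphs with few edges *)

Definition monochromatic (V C : finType) (c : V -> C) (A : {set V}) : bool :=
  (#|c @: A| <= 1)%N.

Lemma monochromaticP (V C : finType) (c : V -> C) (A : {set V}) :
  reflect {in A &, forall x y, c x = c y} (monochromatic c A).
Proof.
apply: (iffP card_le1_eqP) => [h x y Ax Ay|h].
  by apply: h; apply: imset_f.
by move=> _ _ /imsetP[x Ax ->] /imsetP[y Ay ->]; apply: h.
Qed.

(** In a good colouring with the least number k of colours, every two colours
    are joined by an edge, since otherwise they could be merged; so there are at
    least binomial(k, 2) edges, and few edges force k <= n. *)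
Lemma few_edges_colorable (V : finType) (n : nat) (E : {set {set V}}) :
    {in E, forall A : {set _}, 1 < #|A|}%N -> (#|E| < 'C(n.+1, 2))%N ->
  exists c : V -> 'I_n, {in E, forall A : {set _}, ~~ monochromatic c A}.
Proof.
move=> E_gt1 cardE.
pose good k := `[< exists c : V -> 'I_k,
  {in E, forall A : {set _}, ~~ monochromatic c A} >].
have ex_good : exists k, good k.
  exists #|V|; apply/asboolP; exists enum_rank => A /E_gt1.
  by rewrite -ltnNge card_imset //; apply: enum_rank_inj.
case: (ex_minnP ex_good) => k /asboolP[c c_good] k_min.
have [le_kn|lt_nk] := leqP k n.
  exists (widen_ord le_kn \o c) => A /c_good.
  apply: contraNN => /monochromaticP mono.
  apply/monochromaticP => x y Ax Ay; apply/val_inj.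
  by have /(congr1 val) := mono x y Ax Ay.
case: k => [//|k] in c c_good k_min lt_nk *.
suff: ('C(k.+1, 2) <= #|E|)%N.
  by have := leq_bin2l 2 lt_nk; lia.
have <- : #|[set B : {set 'I_k.+1} | #|B| == 2%N]| = 'C(k.+1, 2).
  by rewrite card_draws card_ord.
have sub : [set B : {set 'I_k.+1} | #|B| == 2%N] \subset
    [set c @: (A : {set V}) | A in E].
  apply/subsetP => B; rewrite inE => /cards2P[b [a [ba ->]]] {B}.
  apply/negPn/negP => /imsetP no_edge.
  case: (unliftP b a) => [a' def_a|ab]; last by rewrite ab eqxx in ba.
  (* [merge] identifies the colours a and b, and the remaining colours are
     renumbered so that k of them are left. *)
  pose merge y := odflt a' (unlift b y).
  have merge_inj y1 y2 : merge y1 = merge y2 -> y1 != y2 ->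
      (y1 \in [set b; a]) && (y2 \in [set b; a]).
    rewrite /merge !inE.
    case: (unliftP b y1) => [y1'|] ->; case: (unliftP b y2) => [y2'|] -> /=.
    - by move=> ->; rewrite eqxx.
    - by move=> ->; rewrite -def_a !eqxx !orbT.
    - by move=> <-; rewrite -def_a !eqxx !orbT.
    - by rewrite eqxx.
  suff /k_min : good k by rewrite ltnn.
  apply/asboolP; exists (merge \o c) => A EA.
  apply/negP => /monochromaticP mono.
  have /card_gt1P[y1 [y2 [Ay1 Ay2 ny]]] : (1 < #|c @: A|)%N.
    by rewrite ltnNge; apply: c_good.
  have merge_eq y y' : y \in c @: A -> y' \in c @: A -> merge y = merge y'.
    by move=> /imsetP[x Ax ->] /imsetP[x' Ax' ->]; apply: mono.
  apply: no_edge; exists A => //; apply/esym/eqP.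
  rewrite eqEcard cards2 ba andbC; apply/andP; split.
    by apply/card_gt1P; exists y1, y2.
  apply/subsetP => y Ay.
  have [->|yy1] := eqVneq y y1.
    by have /andP[] := merge_inj _ _ (merge_eq _ _ Ay1 Ay2) ny.
  by have /andP[] := merge_inj _ _ (merge_eq _ _ Ay Ay1) yy1.
exact: leq_trans (subset_leq_card sub) (leq_imset_card _ _).
Qed.

(** * Minors of star shape *)

Lemma exists_other2 (m : nat) (i j : 'I_m) :
  (2 < m)%N -> exists k, (k != i) && (k != j).
Proof.
move=> m_gt2; have : (0 < #|~: [set i; j]|)%N.
  rewrite cardsCs setCK card_ord subn_gt0 (leq_ltn_trans _ m_gt2) //.
  by rewrite cards2; case: eqP.
by case/card_gt0P => k; rewrite !inE negb_or; exists k.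
Qed.

Lemma exists_injection3 (m n : nat) (i j k : 'I_m) :
    (n.+2 < m)%N -> i != j -> i != k -> j != k ->
  exists f : 'I_n.+3 -> 'I_m,
    [/\ injective f, f 0 = i, f 1 = j & f 2 = k].
Proof.
move=> lt_nm ij ik jk; pose w := @widen_ord n.+3 m lt_nm.
have w_inj : injective w by move=> a b /(congr1 val) /= h; apply: val_inj.
(* Each transposition puts one more index in place and keeps those already
   placed. *)
pose s1 := tperm (w 0) i.
pose s2 := (s1 * tperm (s1 (w 1%R)) j)%g.
pose s3 := (s2 * tperm (s2 (w 2%R)) k)%g.
have s1E : s1 (w 0) = i by rewrite tpermL.
have s2E0 : s2 (w 0) = i.
  rewrite permM s1E [LHS]tpermD //; last by rewrite eq_sym.
  by rewrite -s1E (inj_eq perm_inj) (inj_eq w_inj).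
have s2E1 : s2 (w 1) = j by rewrite permM tpermL.
exists (s3 \o w); split => /=.
- by apply: inj_comp w_inj; apply: perm_inj.
- rewrite permM s2E0 [LHS]tpermD 1?eq_sym //.
  by rewrite eq_sym -s2E0 (inj_eq perm_inj) (inj_eq w_inj).
- rewrite permM s2E1 [LHS]tpermD 1?eq_sym //.
  by rewrite eq_sym -s2E1 (inj_eq perm_inj) (inj_eq w_inj).
- by rewrite permM tpermL.
Qed.

Definition unit_diag_mx (R : nzRingType) (n : nat) (h : 'I_n -> 'I_n -> R) :=
  \matrix_(a, b) (if a == b then 1 else h a b).

(** For a kernel vector u, the equation at a leaf reads u_b = - u_0 h_(0b), and
    inserting this in the equation at the centre leaves
    u_0 (1 - sum of the h_(0b)^2) = 0, where the sum is at least 2. *)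
Lemma star_mx_unit (R : realFieldType) (n : nat) (h : 'I_n.+3 -> 'I_n.+3 -> R) :
    (forall a b, a != 0 -> b != 0 -> a != b -> h a b = 0) ->
    (forall a, h a 0 = h 0 a) -> h 0 1 = 1 -> h 0 2 = 1 ->
  \det (unit_diag_mx h) != 0.
Proof.
move=> h_star h_sym h01 h02; apply/negP => /det0P[u u_neq0 uM0].
have colE b : u 0 b + \sum_(a | a != b) u 0 a * h a b = 0.
  have /matrixP/(_ 0 b) := uM0; rewrite !mxE (bigD1 b) //= !mxE eqxx mulr1.
  move=> sum0; rewrite -[RHS]sum0.
  by congr (_ + _); apply: eq_bigr => a ab; rewrite mxE (negPf ab).
have leafE b : b != 0 -> u 0 b = - (u 0 0 * h 0 b).
  move=> b0; have := colE b; rewrite (bigD1 0) 1?eq_sym //= big1 ?addr0.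
    by move/eqP; rewrite addr_eq0 => /eqP.
  by move=> a /andP[ab a0]; rewrite h_star // mulr0.
have := colE 0.
rewrite (eq_bigr (fun a => - (u 0 0 * h 0 a ^+ 2))) => [|a a0]; last first.
  by rewrite leafE // h_sym mulNr expr2 mulrA.
rewrite sumrN -mulr_sumr -{1}[u 0 0]mulr1 -mulrBr => /eqP; rewrite mulf_eq0.
have -> : (1 - \sum_(a | a != 0) h 0 a ^+ 2 == 0) = false.
  apply/negbTE; rewrite subr_eq0 lt_eqF //.
  rewrite (bigD1 1) // (bigD1 2) //= h01 h02 expr1n addrA.
  by rewrite ltr_wpDr ?sumr_ge0 // => *; rewrite ?sqr_ge0 //; lra.
rewrite orbF => /eqP u00; case/eqP: u_neq0; apply/rowP => b; rewrite mxE.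
by have [->|/leafE ->] := eqVneq b 0; rewrite u00 // mul0r oppr0.
Qed.

(** * Edge permutations with singular minors *)

(** The minors that vanish identically for generic [v], evaluated at a
    configuration of standard basis vectors, that is, at a colouring. *)
Definition singular_on_colorings (R : nzRingType) (m n : nat)
    (s : {set 'I_m} -> {set 'I_m}) :=
  forall (f : 'I_n.+1 -> 'I_m) (c : 'I_m -> 'I_n), injective f ->
  \det (unit_diag_mx
    (fun a b => (monochromatic c (s [set f a; f b]))%:R : R)) = 0.

(** Colour classes of [c0] stand for a contraction of the vertex set. The images
    of edges that survive the contraction are too few to prevent an n-colouring
    of the contracted graph; composed with [c0], it makes monochromatic exactly
    the images that [c0] contracts. If these come from edges at i only, two of
    them being ij and ik, the minor on indices containing i, j and k is that of
    a star, and it is not zero. *)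
Lemma no_star_collapse (R : realFieldType) (m n : nat)
    (s : {set 'I_m} -> {set 'I_m}) (i j k : 'I_m) (c0 : 'I_m -> 'I_m) :
    (n.+2 < m)%N -> singular_on_colorings R n.+2 s ->
    i != j -> i != k -> j != k ->
    (forall A : {set 'I_m}, #|A| = 2%N -> #|s A| = 2%N) ->
    monochromatic c0 (s [set i; j]) -> monochromatic c0 (s [set i; k]) ->
  ~ (forall A : {set 'I_m}, #|A| = 2%N -> monochromatic c0 (s A) -> i \in A).
Proof.
move=> lt_nm s_sing ij ik jk s2 mono_j mono_k mono_star.
have [f [f_inj f0 f1 f2]] := exists_injection3 lt_nm ij ik jk.
pose T (B : {set 'I_n.+3}) := s (f @: B).
have fpair a b : f @: [set a; b] = [set f a; f b] by rewrite imsetU1 imset_set1.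
pose D : {set {set 'I_n.+3}} := [set B : {set 'I_n.+3} | #|B| == 2%N].
pose E := [set c0 @: T B | B in D & ~~ monochromatic c0 (T B)].
have E_gt1 : {in E, forall A : {set _}, 1 < #|A|}%N.
  by move=> A /imsetP[B]; rewrite inE => /andP[_ nB] ->; rewrite ltnNge.
have cardE : (#|E| < 'C(n.+3, 2))%N.
  apply: leq_ltn_trans (leq_imset_card _ _) _.
  have <- : #|D| = 'C(n.+3, 2) by rewrite card_draws card_ord.
  apply: proper_card; apply/properP; split.
    by apply/subsetP => B; rewrite inE => /andP[].
  exists [set 0; 1]; first by rewrite inE cards2.
  by rewrite inE /= /T fpair f0 f1 mono_j andbF.
have [c' c'_good] := few_edges_colorable E_gt1 cardE.
pose c := c' \o c0.
have monoE B : B \in D -> monochromatic c (T B) = monochromatic c0 (T B).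
  move=> DB; apply/idP/idP => [mono|/monochromaticP mono]; last first.
    by apply/monochromaticP => x y Ax Ay; rewrite /c /= (mono x y).
  apply: contraLR mono => nmono.
  by rewrite /monochromatic imset_comp; apply/c'_good/imset_f; rewrite inE DB.
have pairD a b : a != b -> [set a; b] \in D by move=> ab; rewrite inE cards2 ab.
pose h a b : R := (monochromatic c (s [set f a; f b]))%:R.
have hE a b : a != b -> h a b = (monochromatic c0 (s [set f a; f b]))%:R.
  by move=> ab; rewrite /h -fpair -/(T _) monoE ?pairD.
have := star_mx_unit (h := h); rewrite s_sing // eqxx => contra; apply: notF.
apply: contra.
- move=> a b a0 b0 ab; rewrite hE //.
  case: (boolP (monochromatic _ _)) => // /mono_star.
  rewrite cards2 (inj_eq f_inj) ab => /(_ erefl).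
  by rewrite !inE -f0 !(inj_eq f_inj) !(eq_sym 0) (negPf a0) (negPf b0).
- by move=> a; rewrite /h setUC.
- by rewrite hE // f0 f1 mono_j.
- by rewrite hE // f0 f2 mono_k.
Qed.

Lemma card2_with (T : finType) (A : {set T}) (b : T) :
  #|A| = 2%N -> b \in A -> exists2 a, a != b & A = [set b; a].
Proof.
move=> A2 Ab; have : #|A :\ b| == 1%N.
  by move: (cardsD1 b A); rewrite Ab A2; lia.
case/cards1P => a Aba; exists a; last by rewrite -(setD1K Ab) Aba.
by have /setD1P[] : a \in A :\ b by rewrite Aba set11.
Qed.

Lemma set2_inter (T : finType) (P Q : {set T}) :
    #|P| = 2%N -> #|Q| = 2%N -> P != Q -> P :&: Q != set0 ->
  exists b a c, [/\ P = [set a; b], Q = [set b; c], a != b, b != c & a != c].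
Proof.
move=> P2 Q2 nPQ /set0Pn[b /setIP[Pb Qb]].
have [a ab Pab] := card2_with P2 Pb; have [c cb Qcb] := card2_with Q2 Qb.
exists b, a, c; split=> //; first by rewrite setUC.
  by rewrite eq_sym.
by apply: contraNneq nPQ => ac; rewrite Pab Qcb ac.
Qed.

(** Otherwise the two disjoint images could be contracted, each to one of its
    vertices, and no third edge of the complete graph would be contracted. *)
Lemma adjacent_edges (R : realFieldType) (m n : nat)
    (s : {set 'I_m} -> {set 'I_m}) (i j k : 'I_m) :
    (n.+2 < m)%N -> singular_on_colorings R n.+2 s ->
    (forall A : {set 'I_m}, #|A| = 2%N -> #|s A| = 2%N) ->
    (forall A B : {set 'I_m}, #|A| = 2%N -> #|B| = 2%N -> s A = s B -> A = B) ->
    i != j -> i != k -> j != k ->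
  s [set i; j] :&: s [set i; k] != set0.
Proof.
move=> lt_nm s_sing s2 s_inj ij ik jk; apply/negP => /eqP disj.
set P := s [set i; j] in disj *; set Q := s [set i; k] in disj *.
have P2 : #|P| = 2%N by rewrite s2 // cards2 ij.
have Q2 : #|Q| = 2%N by rewrite s2 // cards2 ik.
have /card_gt0P[p Pp] : (0 < #|P|)%N by rewrite P2.
have /card_gt0P[q Qq] : (0 < #|Q|)%N by rewrite Q2.
have PnQ x : x \in P -> x \notin Q.
  by move=> Px; apply/negP => Qx; have := in_set0 x; rewrite -disj inE Px Qx.
pose c0 x := if x \in P then p else if x \in Q then q else x.
apply: (no_star_collapse (c0 := c0) lt_nm s_sing ij ik jk s2).
- by apply/monochromaticP => x y Px Py; rewrite /c0 -/P Px Py.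
- apply/monochromaticP => x y Qx Qy; rewrite /c0 -/Q Qx Qy.
  by rewrite !ifN //; [apply: contraL Qy | apply: contraL Qx]; apply: PnQ.
move=> A A2 /monochromaticP mono.
have cases x y : x != y -> c0 x = c0 y ->
    (x \in P) && (y \in P) || (x \in Q) && (y \in Q).
  rewrite /c0 => xy; case Px: (x \in P); case Py: (y \in P) => //=.
  - case: ifP => Qy // ?; last by subst y; rewrite Pp in Py.
    by subst q; have := PnQ _ Pp; rewrite Qq.
  - case: ifP => Qx // ?; last by subst x; rewrite Pp in Px.
    by subst q; have := PnQ _ Pp; rewrite Qq.
  - case Qx: (x \in Q); case Qy: (y \in Q) => // e.
    + by subst y; rewrite Qq in Qy.
    + by subst x; rewrite Qq in Qx.
    + by rewrite e eqxx in xy.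
have /eqP/cards2P[x [y [xy sA]]] := s2 A A2.
have eqA (B : {set 'I_m}) : #|B| = 2%N -> (x \in s B) && (y \in s B) -> A = B.
  move=> B2 /andP[Bx By]; apply: s_inj => //; apply/eqP.
  rewrite eqEcard (s2 A A2) (s2 B B2) leqnn andbT sA.
  by apply/subsetP => z /set2P[] ->.
have /orP[] : (x \in P) && (y \in P) || (x \in Q) && (y \in Q).
  by apply: cases => //; apply: mono; rewrite sA !inE eqxx ?orbT.
- by move/eqA ->; rewrite ?cards2 ?ij // set21.
- by move/eqA ->; rewrite ?cards2 ?ik // set21.
Qed.

(** Otherwise the triangle could be contracted to a point, which contracts no
    other edge. This excludes the exceptional automorphisms of the line graph of
    the complete graph on four vertices, which exchange stars and triangles and
    preserve adjacency. *)
Lemma star_not_triangle (R : realFieldType) (m n : nat)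
    (s : {set 'I_m} -> {set 'I_m}) (i j k l a b c : 'I_m) :
    (n.+2 < m)%N -> singular_on_colorings R n.+2 s ->
    (forall A : {set 'I_m}, #|A| = 2%N -> #|s A| = 2%N) ->
    (forall A B : {set 'I_m}, #|A| = 2%N -> #|B| = 2%N -> s A = s B -> A = B) ->
    i != j -> i != k -> i != l -> j != k ->
    s [set i; j] = [set a; b] -> s [set i; k] = [set b; c] ->
  s [set i; l] <> [set a; c].
Proof.
move=> lt_nm s_sing s2 s_inj ij ik il jk sj sk sl.
pose D := [set a; b; c]; pose c0 x := if x \in D then a else x.
have Da : a \in D by rewrite !inE eqxx.
apply: (no_star_collapse (c0 := c0) lt_nm s_sing ij ik jk s2).
- rewrite sj; apply/monochromaticP => x y /set2P[] -> /set2P[] ->;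
    by rewrite /c0 !inE !eqxx ?orbT.
- rewrite sk; apply/monochromaticP => x y /set2P[] -> /set2P[] ->;
    by rewrite /c0 !inE !eqxx ?orbT.
move=> A A2 /monochromaticP mono.
have /eqP/cards2P[x [y [xy sA]]] := s2 A A2.
have /andP[Dx Dy] : (x \in D) && (y \in D).
  have : c0 x = c0 y by apply: mono; rewrite sA !inE eqxx ?orbT.
  rewrite /c0; case Dx: (x \in D); case Dy: (y \in D) => // e.
  - by rewrite -e Da in Dy.
  - by rewrite e Da in Dx.
  - by rewrite e eqxx in xy.
have eqA (B : {set 'I_m}) : i \in B -> #|B| = 2%N -> s A = s B -> i \in A.
  by move=> Bi B2 /s_inj ->.
have iab : #|[set i; j]| = 2%N /\ #|[set i; k]| = 2%N /\ #|[set i; l]| = 2%N.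
  by rewrite !cards2 ij ik il.
case: iab => ij2 [ik2 il2].
have := eqA _ (set21 i j) ij2; have := eqA _ (set21 i k) ik2.
have := eqA _ (set21 i l) il2.
rewrite sA sj sk sl.
move: Dx Dy xy; rewrite !inE -!orbA.
move=> /or3P[] /eqP-> /or3P[] /eqP->; rewrite ?eqxx //.
all: by move=> _ h1 h2 h3; first [exact: h1 | exact: h2 | exact: h3 |
  apply: h1; exact: setUC | apply: h2; exact: setUC | apply: h3; exact: setUC].
Qed.

(** The images of the edges at i meet pairwise and contain no triangle, so they
    share a vertex p(i). As [s] is injective, it maps the m-1 edges at i onto
    all the edges at p(i); hence p(i) = p(j) would leave no room for the image
    of an edge at j that avoids i. *)
Lemma edge_map_from_vertex_map (R : realFieldType) (m n : nat)
    (s : {set 'I_m} -> {set 'I_m}) :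
    (n.+2 < m)%N -> singular_on_colorings R n.+2 s ->
    (forall A : {set 'I_m}, #|A| = 2%N -> #|s A| = 2%N) ->
    (forall A B : {set 'I_m}, #|A| = 2%N -> #|B| = 2%N -> s A = s B -> A = B) ->
  exists2 p : 'I_m -> 'I_m, injective p &
    forall i j, i != j -> s [set i; j] = [set p i; p j].
Proof.
move=> lt_nm s_sing s2 s_inj.
have m_gt2 : (2 < m)%N by apply: leq_trans lt_nm.
have centre i : exists q, forall j, j != i -> q \in s [set i; j].
  have [j /andP[ji _]] := exists_other2 i i m_gt2.
  have [k /andP[ki kj]] := exists_other2 i j m_gt2.
  rewrite eq_sym in ji; rewrite eq_sym in ki; rewrite eq_sym in kj.
  have ij2 : #|[set i; j]| = 2%N by rewrite cards2 ji.
  have ik2 : #|[set i; k]| = 2%N by rewrite cards2 ki.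
  have njk : s [set i; j] != s [set i; k].
    apply: contraNneq kj => /(s_inj _ _ ij2 ik2)/setP/(_ j).
    by rewrite !inE eqxx orbT eq_sym (negPf ji).
  have [b [a [c [sj sk ab bc ac]]]] := set2_inter (s2 _ ij2) (s2 _ ik2) njk
    (adjacent_edges lt_nm s_sing s2 s_inj ji ki kj).
  exists b => l li; rewrite eq_sym in li.
  have [<-|lj] := eqVneq j l; first by rewrite sj set22.
  have [<-|lk] := eqVneq k l; first by rewrite sk set21.
  apply/negPn/negP => nb.
  have meets x : i != x -> x != l -> s [set i; x] :&: s [set i; l] != set0.
    by move=> ix xl; apply: (adjacent_edges lt_nm s_sing).
  case/set0Pn: (meets j ji lj) => x.
  rewrite sj !inE => /andP[/orP[]/eqP-> Rx]; last by rewrite Rx in nb.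
  case/set0Pn: (meets k ki lk) => y.
  rewrite sk !inE => /andP[/orP[]/eqP-> Ry]; first by rewrite Ry in nb.
  apply: (star_not_triangle lt_nm s_sing s2 s_inj ji ki li kj sj sk).
  apply/esym/eqP; rewrite eqEcard cards2 ac s2 ?cards2 ?li // andbT.
  by apply/subsetP => z /set2P[] ->.
have [p pP] := choice centre.
have p_in i j : i != j -> p i \in s [set i; j].
  by move=> ij; apply: pP; rewrite eq_sym.
have p_inj : injective p.
  move=> i j pij; apply/eqP/negPn/negP => ij.
  have [k /andP[ki kj]] := exists_other2 i j m_gt2.
  pose S (q : 'I_m) := [set [set q; x] | x in [set~ q]].
  have cardS q : #|S q| = m.-1.
    rewrite card_in_imset ?cardsC1 ?card_ord // => x y; rewrite !inE => xq yq.
    move/setP/(_ x).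
    by rewrite !inE eqxx orbT (negPf xq) => /esym/eqP.
  have S_pair q (A : {set 'I_m}) : #|A| = 2%N -> q \in A -> A \in S q.
    move=> A2 /(card2_with A2)[x xq ->].
    by apply/imsetP; exists x; rewrite // !inE.
  have U2 A : A \in [set j; k] |: S i -> #|A| = 2%N.
    case/setU1P => [->|/imsetP[x]]; first by rewrite cards2 eq_sym kj.
    by rewrite !inE => xi ->; rewrite cards2 eq_sym xi.
  have : (#|s @: ([set j; k] |: S i)| <= #|S (p i)|)%N.
    apply/subset_leq_card/subsetP => _ /imsetP[A UA ->].
    case/setU1P: UA => [->|/imsetP[x xi ->]].
      apply: S_pair; rewrite ?s2 ?cards2 ?(eq_sym j) ?kj //.
      by rewrite pij p_in // eq_sym.
    rewrite !inE eq_sym in xi.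
    by apply: S_pair; rewrite ?s2 ?cards2 ?xi // p_in.
  have jkS : [set j; k] \notin S i.
    apply/imsetP => -[x _ /setP/(_ i)]; rewrite !inE eqxx (negPf ij) eq_sym.
    by rewrite (negPf ki).
  rewrite card_in_imset; first by rewrite cardsU1 jkS !cardS; lia.
  by move=> A B UA UB; apply: s_inj; apply: U2.
exists p => // i j ij; apply/esym/eqP.
rewrite eqEcard cards2 (inj_eq p_inj) ij s2 ?cards2 ?ij // andbT.
apply/subsetP => z /set2P[] ->; first exact: p_in.
by rewrite setUC; apply: p_in; rewrite eq_sym.
Qed.

(** * Generic polynomials on the product of spheres *)

Lemma exists_nonroot (R : numDomainType) (p : {poly R}) :
  p != 0 -> exists t, p.[t] != 0.
Proof.
move=> p_neq0; pose rs : seq R := [seq i%:R | i <- iota 0 (size p)].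
have rs_uniq : uniq rs.
  by rewrite map_inj_uniq ?iota_uniq // => i j /eqP; rewrite eqr_nat => /eqP.
case: (boolP (all (root p) rs)) => [all_roots|].
  by have := max_poly_roots p_neq0 all_roots rs_uniq;
    rewrite size_map size_iota ltnn.
by rewrite -has_predC => /hasP[t _ /= pt]; exists t.
Qed.

(** Rational functions on the line with poles at zeros of [D] only, given by
    values so that they can be composed with polynomials in many variables. *)
Definition rational_off (R : nzRingType) (D : {poly R}) (f : R -> R) :=
  exists (N : nat) (P : {poly R}),
    forall t, D.[t] != 0 -> f t * D.[t] ^+ N = P.[t].

Section RationalOff.
Variables (R : comNzRingType) (D : {poly R}).

Lemma rational_off_cst c : rational_off D (fun=> c).
Proof. by exists 0%N, c%:P => t _; rewrite expr0 mulr1 hornerC. Qed.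

Lemma rational_offD f g :
  rational_off D f -> rational_off D g -> rational_off D (fun t => f t + g t).
Proof.
move=> [N [P fP]] [M [Q gQ]]; exists (N + M)%N.
exists (P * D ^+ M + Q * D ^+ N) => t Dt.
by rewrite hornerD !hornerM !horner_exp -fP // -gQ // exprD; ring.
Qed.

Lemma rational_offM f g :
  rational_off D f -> rational_off D g -> rational_off D (fun t => f t * g t).
Proof.
move=> [N [P fP]] [M [Q gQ]]; exists (N + M)%N, (P * Q) => t Dt.
by rewrite hornerM -fP // -gQ // exprD; ring.
Qed.

Lemma rational_off_prod (I : finType) (f : I -> R -> R) :
  (forall i, rational_off D (f i)) -> rational_off D (fun t => \prod_i f i t).
Proof.
move=> fr; elim: (index_enum I) => [|i s IHs].
  have [N [P NP]] := rational_off_cst 1; exists N, P => t /NP <-.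
  by rewrite big_nil.
have [N [P NP]] := rational_offM (fr i) IHs; exists N, P => t /NP <-.
by rewrite big_cons.
Qed.

Lemma rational_offX f k :
  rational_off D f -> rational_off D (fun t => f t ^+ k).
Proof.
move=> fr; elim: k => [|k IHk]; first exact: rational_off_cst.
have [N [P NP]] := rational_offM fr IHk; exists N, P => t /NP <-.
by rewrite exprS.
Qed.

Lemma rational_off_meval (l : nat) (y : R -> 'I_l -> R) (p : {mpoly R[l]}) :
    (forall i, rational_off D (fun t => y t i)) ->
  rational_off D (fun t => p.@[y t]).
Proof.
move=> yr; elim/mpolyind: p => [|c mon p _ _ IHp].
  have [N [P NP]] := rational_off_cst 0; exists N, P => t /NP <-.
  by rewrite meval0.
have mon_r : rational_off D (fun t => \prod_i y t i ^+ mon i).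
  by apply: rational_off_prod => i; apply: rational_offX.
have [N [P NP]] := rational_offD (rational_offM (rational_off_cst c) mon_r) IHp.
by exists N, P => t /NP <-; rewrite mevalD mevalZ mevalX.
Qed.

End RationalOff.

Definition sqnorm (R : pzRingType) (n : nat) (x : 'cV[R]_n) :=
  \sum_k x k 0 ^+ 2.

(** The image of the basis vector e_0 under the reflection that fixes the line
    spanned by [z], namely 2 <e_0, z> / <z, z> z - e_0: a rational
    parametrization of the sphere. *)
Definition line_reflection (R : fieldType) (n : nat) (z : 'cV[R]_n.+1) :
    'cV[R]_n.+1 :=
  \col_k (2 * z 0 0 / sqnorm z * z k 0 - (k == 0)%:R).

Lemma line_reflection_sqnorm (R : fieldType) (n : nat) (z : 'cV[R]_n.+1) :
  sqnorm z != 0 -> sqnorm (line_reflection z) = 1.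
Proof.
move=> z_neq0; set a := 2 * z 0 0 / sqnorm z.
have -> : sqnorm (line_reflection z) =
    a ^+ 2 * sqnorm z - 2 * a * z 0 0 + 1.
  rewrite {1}/sqnorm (eq_bigr (fun k => a ^+ 2 * z k 0 ^+ 2 -
      (k == 0)%:R * (2 * a * z k 0 - 1))) => [|k _]; last first.
    by rewrite mxE -/a; case: eqP => _ /=; ring.
  rewrite big_split /= -mulr_sumr -/(sqnorm z) sumrN (bigD1 0) //= mul1r.
  rewrite big1 ?addr0 => [|k /negPf->]; last by rewrite mul0r.
  by ring.
by rewrite /a; field.
Qed.

(** Not vanishing identically on the product of spheres. The witness is a
    parameter and not a point of the sphere, since two parameters can be joined
    by a line. *)
Definition generic_poly (R : realType) (m n : nat) (p : {mpoly R[m * n.+1]}) :=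
  exists2 z : 'I_m -> 'cV[R]_n.+1, (forall i, sqnorm (z i) != 0) &
    p.@[coords (fun i => line_reflection (z i))] != 0.

Lemma coordsE (R : realType) (m n : nat) (v : 'I_m -> 'cV[R]_n) i k :
  coords v (mxvec_index i k) = v i k 0.
Proof. by rewrite /coords mxvecE mxE. Qed.

(** On the line joining the two witnesses the coordinates of the points are
    rational in t, with poles at the zeros of the product D of the square norms
    of the parameters. Up to powers of D, [p] and [q] become polynomials in t
    that are not zero, as their values at 0 and at 1 show; so some t avoids the
    zeros of both and of D. *)
Lemma generic_polyM (R : realType) (m n : nat) (p q : {mpoly R[m * n.+1]}) :
  generic_poly p -> generic_poly q -> generic_poly (p * q).
Proof.
move=> [z z_neq0 pz] [z' z'_neq0 qz'].
pose Z i k : {poly R} := (z i k 0)%:P + (z' i k 0 - z i k 0)%:P * 'X.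
pose y t i : 'cV[R]_n.+1 := \col_k (Z i k).[t].
have y0 : y 0 = z.
  apply: funext => i; apply/colP => k.
  by rewrite mxE hornerD hornerM hornerX !hornerC; ring.
have y1 : y 1 = z'.
  apply: funext => i; apply/colP => k.
  by rewrite mxE hornerD hornerM hornerX !hornerC; ring.
pose S i : {poly R} := \sum_k Z i k ^+ 2.
have SE i t : (S i).[t] = sqnorm (y t i).
  by rewrite /S horner_sum; apply: eq_bigr => k _; rewrite horner_exp mxE.
pose D := \prod_i S i.
have DE t : D.[t] = \prod_i sqnorm (y t i).
  by rewrite /D horner_prod; apply: eq_bigr => i _; rewrite SE.
have D_neq0 t : (D.[t] != 0) = [forall i, sqnorm (y t i) != 0].
  rewrite DE; apply/prodf_neq0/forallP => [h i|h i _]; exact: h.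
have coords_r l :
    rational_off D (fun t => coords (fun i => line_reflection (y t i)) l).
  case/mxvec_indexP: l => i k.
  exists 1%N, (2%:P * Z i 0 * Z i k * \prod_(j | j != i) S j -
    (k == 0)%:R%:P * D) => t.
  rewrite D_neq0 => /forallP/(_ i) yi; rewrite coordsE expr1.
  rewrite hornerD hornerN !hornerM !hornerC mxE mulrBl; congr (_ - _).
  rewrite /D (bigD1 i) //= hornerM SE !mxE.
  by field.
have [N [P NP]] := rational_off_meval p coords_r.
have [M [Q MQ]] := rational_off_meval q coords_r.
have D0 : D.[0] != 0 by rewrite D_neq0 y0; apply/forallP.
have D1 : D.[1] != 0 by rewrite D_neq0 y1; apply/forallP.
have P_neq0 : P != 0.
  apply: contraTneq pz => P0; have /eqP := NP 0 D0.
  by rewrite y0 P0 horner0 mulf_eq0 expf_eq0 (negPf D0) andbF orbF negbK.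
have Q_neq0 : Q != 0.
  apply: contraTneq qz' => Q0; have /eqP := MQ 1 D1.
  by rewrite y1 Q0 horner0 mulf_eq0 expf_eq0 (negPf D1) andbF orbF negbK.
have DD_neq0 : D != 0 by apply: contraNneq D0 => ->; rewrite horner0.
have /exists_nonroot[t] : D * P * Q != 0 by rewrite !mulf_neq0.
rewrite !hornerM !mulf_eq0 !negb_or => /andP[/andP[Dt Pt] Qt].
exists (y t); first by apply/forallP; rewrite -D_neq0.
rewrite mevalM mulf_neq0 //.
  by move: Pt; rewrite -NP //; apply: contraNneq => ->; rewrite mul0r.
by move: Qt; rewrite -MQ //; apply: contraNneq => ->; rewrite mul0r.
Qed.

(** * The polynomials that define the open set *)

(** For a two-element set [{i, j}] this is the inner product of [v i] and [v j]
    ([dot2]); a product over the set needs no choice of an order on it. *)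
Definition dot (R : realType) (m n : nat) (v : 'I_m -> 'cV[R]_n)
    (A : {set 'I_m}) : R :=
  \sum_k \prod_(i in A) v i k 0.

Definition dot_poly (R : realType) (m n : nat) (A : {set 'I_m}) :
    {mpoly R[m * n]} :=
  \sum_k \prod_(i in A) 'X_(mxvec_index i k).

Lemma dot_polyE (R : realType) (m n : nat) (v : 'I_m -> 'cV[R]_n)
    (A : {set 'I_m}) :
  (dot_poly R n A).@[coords v] = dot v A.
Proof.
rewrite rmorph_sum; apply: eq_bigr => k _; rewrite rmorph_prod.
by apply: eq_bigr => i _; rewrite /= mevalXU coordsE.
Qed.

Lemma dot2 (R : realType) (m n : nat) (v : 'I_m -> 'cV[R]_n) (i j : 'I_m) :
  i != j -> dot v [set i; j] = \sum_k v i k 0 * v j k 0.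
Proof.
move=> ij; apply: eq_bigr => k _.
by rewrite big_setU1 ?inE //= big_set1.
Qed.

(** The entries are indexed by an arbitrary function [t] to edges, which stands
    for both the choice of the rows of a minor and the edge permutation. *)
Definition minor_poly (R : realType) (m n l : nat)
    (t : 'I_l * 'I_l -> {set 'I_m}) : {mpoly R[m * n]} :=
  \det (unit_diag_mx (fun a b => dot_poly R n (t (a, b)))).

Lemma minor_polyE (R : realType) (m n l : nat) (t : 'I_l * 'I_l -> {set 'I_m})
    (v : 'I_m -> 'cV[R]_n) :
  (minor_poly R n t).@[coords v] =
    \det (unit_diag_mx (fun a b => dot v (t (a, b)))).
Proof.
rewrite -det_map_mx; congr (\det _); apply/matrixP => a b; rewrite !mxE.
by case: eqP => _ /=; rewrite ?meval1 ?dot_polyE.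
Qed.

Definition frame_poly (R : realType) (m n : nat) (w : 'I_n -> 'I_m) :
    {mpoly R[m * n]} :=
  \det (\matrix_(i, k) 'X_(mxvec_index (w i) k)).

Lemma frame_polyE (R : realType) (m n : nat) (w : 'I_n -> 'I_m)
    (v : 'I_m -> 'cV[R]_n) :
  (frame_poly R w).@[coords v] = \det (\matrix_(i, k) v (w i) k 0).
Proof.
rewrite -det_map_mx; congr (\det _); apply/matrixP => i k; rewrite !mxE.
by rewrite /= mevalXU coordsE.
Qed.

Definition basis_config (R : realType) (m n : nat) (c : 'I_m -> 'I_n)
    (i : 'I_m) : 'cV[R]_n :=
  delta_mx (c i) 0.

Lemma dot_basis (R : realType) (m n : nat) (c : 'I_m -> 'I_n) (A : {set 'I_m}) :
  A != set0 -> dot (basis_config R c) A = (monochromatic c A)%:R.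
Proof.
case/set0Pn => x Ax.
have term k : \prod_(i in A) basis_config R c i k 0 =
    [forall i in A, c i == k]%:R.
  case: (boolP [forall i in A, c i == k]) => [/forall_inP cA|].
    by rewrite big1 // => i Ai; rewrite mxE eq_sym (cA i Ai).
  rewrite negb_forall => /existsP[i]; rewrite negb_imply => /andP[Ai ci].
  by rewrite (bigD1 i) //= mxE eq_sym (negPf ci) mul0r.
rewrite /dot (eq_bigr _ (fun k _ => term k)) (bigD1 (c x)) //=.
rewrite big1 ?addr0 => [|k ck].
  congr (nat_of_bool _)%:R.
  apply/forall_inP/monochromaticP => [h y z Ay Az|h y Ay].
    by rewrite (eqP (h y Ay)) (eqP (h z Az)).
  by rewrite (h y x).
case: (boolP [forall i in A, c i == k]) => // /forall_inP/(_ x Ax) /eqP cx.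
by rewrite cx eqxx in ck.
Qed.

(** The reflection of e_0 in the line of e_0 + e_k is e_k, also when k = 0. *)
Lemma generic_at_basis (R : realType) (m n : nat) (p : {mpoly R[m * n.+1]})
    (c : 'I_m -> 'I_n.+1) :
  p.@[coords (basis_config R c)] != 0 -> generic_poly p.
Proof.
move=> pc; pose z i : 'cV[R]_n.+1 := delta_mx 0 0 + delta_mx (c i) 0.
have zE i : sqnorm (z i) = 2 * z i 0 0.
  rewrite /sqnorm (eq_bigr (fun k => (k == 0)%:R * (1 + (k == c i)%:R * 2) +
      (k == c i)%:R)).
    rewrite big_split /= (bigD1 0) //= big1; last first.
      by move=> k /negPf->; rewrite mul0r.
    rewrite (bigD1 (c i)) //= big1 => [|k /negPf-> //].
    by rewrite !mxE !eqxx /= andbT eq_sym; ring.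
  move=> k _; rewrite !mxE eqxx !andbT.
  by case: (k == 0); case: (k == c i) => /=; ring.
have z00 i : z i 0 0 != 0.
  by rewrite !mxE !eqxx /= -natrD pnatr_eq0.
exists z => [i|]; first by rewrite zE mulf_neq0 // pnatr_eq0.
suff -> : (fun i => line_reflection (z i)) = basis_config R c by [].
apply: funext => i; apply/colP => k.
rewrite /line_reflection mxE zE divff ?mulf_neq0 ?pnatr_eq0 // !mxE.
by rewrite !eqxx !andbT; ring.
Qed.

(** Products of such factors do not vanish identically, although which
    polynomials are generic is not known explicitly. *)
Definition generic_factor (R : realType) (m n : nat)
    (p : {mpoly R[m * n.+1]}) :=
  if `[< generic_poly p >] then p else 1.

Lemma generic_factor_generic (R : realType) (m n : nat)
    (p : {mpoly R[m * n.+1]}) :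
  generic_poly (generic_factor p).
Proof.
rewrite /generic_factor; case: asboolP => // _.
by apply: (generic_at_basis (c := fun=> 0)); rewrite meval1 oner_neq0.
Qed.

Lemma generic_factor_prod (R : realType) (m n : nat) (I : finType)
    (p : I -> {mpoly R[m * n.+1]}) :
  generic_poly (\prod_i generic_factor (p i)).
Proof.
apply: big_ind; first 1 last.
- exact: generic_polyM.
- by move=> i _; apply: generic_factor_generic.
by apply: (generic_at_basis (c := fun=> 0)); rewrite meval1 oner_neq0.
Qed.

Lemma generic_factor_eval (R : realType) (m n : nat) (I : finType)
    (p : I -> {mpoly R[m * n.+1]}) v :
    (\prod_i generic_factor (p i)).@[v] != 0 ->
  forall i, generic_poly (p i) -> (p i).@[v] != 0.
Proof.
rewrite rmorph_prod => /prodf_neq0 h i pi; have := h i isT.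
by rewrite /generic_factor asboolT.
Qed.

(** * Gram matrices and distances *)

Lemma gram_det0 (R : fieldType) (n l : nat) (u : 'I_l -> 'cV[R]_n) :
  (n < l)%N -> \det (\matrix_(a, b) \sum_k u a k 0 * u b k 0) = 0.
Proof.
move=> lt_nl; pose A : 'M_(l, n) := \matrix_(a, k) u a k 0.
have -> : \matrix_(a, b) \sum_k u a k 0 * u b k 0 = A *m A^T.
  apply/matrixP => a b; rewrite !mxE; apply: eq_bigr => k _.
  by rewrite !mxE.
apply/eqP; apply: contraLR lt_nl.
rewrite -unitfE -unitmxE -row_free_unit -leqNgt.
by move=> /eqP <-; apply: leq_trans (mxrankM_maxl _ _) (rank_leq_col _).
Qed.

Lemma trmx_mul_eq0 (R : realDomainType) (m n : nat) (A : 'M[R]_(m, n)) :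
  A^T *m A = 0 -> A = 0.
Proof.
move=> AA0; apply/matrixP => i j; rewrite mxE; have /matrixP/(_ j j) := AA0.
rewrite !mxE (eq_bigr (fun k => A k j ^+ 2)) => [|k _]; last by rewrite mxE.
move/eqP; rewrite psumr_eq0 => [|k _]; last exact: sqr_ge0.
by move/allP/(_ i (mem_index_enum _)); rewrite sqrf_eq0 => /eqP.
Qed.

(** Equal Gram matrices have the same linear relations between columns: if
    V x = 0 then |W x| = |V x| = 0. So the rows of W are combinations of those
    of V, which is the factorization W = g V; and V has a right inverse, so that
    (g V)^T (g V) = V^T V gives g^T g = 1. *)
Lemma gram_eq_orthogonal (R : realFieldType) (m n : nat) (V W : 'M[R]_(n, m)) :
    row_free V -> V^T *m V = W^T *m W ->
  exists2 g : 'M_n, g^T *m g = 1%:M & W = g *m V.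
Proof.
move=> V_free VW.
have /submxP[g Wg] : (W <= V)%MS.
  rewrite submxE; apply/eqP/trmx_mul_eq0.
  by rewrite trmx_mul -mulmxA (mulmxA W^T) -VW -!mulmxA mulmx_coker !mulmx0.
exists g => //; apply: (row_free_inj V_free); rewrite mul1mx.
apply: trmx_inj; apply: (row_free_inj V_free).
by rewrite VW Wg !trmx_mul trmxK -!mulmxA.
Qed.

Lemma sqnorm_ge0 (R : realType) (n : nat) (x : 'cV[R]_n) : 0 <= sqnorm x.
Proof. by apply: sumr_ge0 => k _; apply: sqr_ge0. Qed.

Lemma unit_sphereP (R : realType) (n : nat) (x : 'cV[R]_n) :
  unit_sphere x <-> sqnorm x = 1.
Proof.
rewrite /unit_sphere /= /enorm -/(sqnorm x).
split=> [x1|->]; last exact: sqrtr1.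
by rewrite -[LHS]sqr_sqrtr ?sqnorm_ge0 // x1 expr1n.
Qed.

Lemma enorm_sphere (R : realType) (n : nat) (x y : 'cV[R]_n) :
  unit_sphere x -> unit_sphere y ->
  enorm (x - y) ^+ 2 = 2 - 2 * \sum_k x k 0 * y k 0.
Proof.
move=> /unit_sphereP x1 /unit_sphereP y1.
rewrite sqr_sqrtr -?/(sqnorm (x - y)) ?sqnorm_ge0 //.
have two : 2 = sqnorm x + sqnorm y :> R by rewrite x1 y1.
rewrite {1}two /sqnorm mulr_sumr -!big_split -sumrB; apply: eq_bigr => k _ /=.
by rewrite !mxE; ring.
Qed.

Local Open Scope classical_set_scope.

Lemma dot_of_distance (R : realType) (m n : nat) (v w : 'I_m -> 'cV[R]_n) :
    (forall i, unit_sphere (v i)) -> (forall i, unit_sphere (w i)) ->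
    unlabeled_distances w `<=` unlabeled_distances v ->
  forall A : {set 'I_m}, #|A| = 2%N ->
  exists2 B : {set 'I_m}, #|B| = 2%N & dot v B = dot w A.
Proof.
move=> v1 w1 sub A /eqP/cards2P[i [j [ij ->]]].
wlog lt_ij : i j ij / (i < j)%N.
  move=> wl; have [||/val_inj e] := ltngtP i j; first exact: wl.
    by rewrite [[set i; j]%SET]setUC; apply: wl; rewrite eq_sym.
  by rewrite e eqxx in ij.
have [|k [l [lt_kl e]]] := sub (enorm (w i - w j)); first by exists i, j.
have kl : k != l by rewrite neq_ltn lt_kl.
exists [set k; l]%SET; first by rewrite cards2 kl.
have := congr1 (fun d => d ^+ 2) e; rewrite !enorm_sphere // -!dot2 //.
by move/addrI/oppr_inj/mulfI => -> //; rewrite pnatr_eq0.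
Qed.

(** * Determination by unlabeled distances *)

(** The hypotheses on [v] are those that the open set provides: minors that
    vanish at [v] vanish at all configurations of basis vectors, different edges
    have different inner products, and n of the points are independent. *)
Lemma determined_by_distances (R : realType) (m n : nat)
    (v w : 'I_m -> 'cV[R]_n.+2) (f : 'I_n.+2 -> 'I_m) :
    (n.+2 < m)%N ->
    (forall i, unit_sphere (v i)) -> (forall i, unit_sphere (w i)) ->
    (forall t : {ffun 'I_n.+3 * 'I_n.+3 -> {set 'I_m}},
       \det (unit_diag_mx (fun a b => dot v (t (a, b)))) = 0 ->
     forall c : 'I_m -> 'I_n.+2,
       \det (unit_diag_mx (fun a b =>
         dot (basis_config R c) (t (a, b)))) = 0) ->
    (forall A B : {set 'I_m},
       #|A| = 2%N -> #|B| = 2%N -> dot v A = dot v B -> A = B) ->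
    \det (\matrix_(i, k) v (f i) k 0) != 0 ->
    unlabeled_distances w = unlabeled_distances v ->
  exists2 g : 'M[R]_n.+2, orthogonal_mx g &
    range w = range (fun i => g *m v i).
Proof.
move=> lt_nm v1 w1 degen dot_inj frame dist.
have sub_wv : unlabeled_distances w `<=` unlabeled_distances v by rewrite dist.
have sub_vw : unlabeled_distances v `<=` unlabeled_distances w by rewrite dist.
pose s (A : {set 'I_m}) : {set 'I_m} :=
  odflt set0%SET [pick B : {set 'I_m} | (#|B| == 2%N) && (dot v B == dot w A)].
have sP (A : {set 'I_m}) : #|A| = 2%N -> #|s A| = 2%N /\ dot v (s A) = dot w A.
  move=> A2; rewrite /s; case: pickP => [B /andP[/eqP ? /eqP ?] //|noB].
  have [B B2 dB] := dot_of_distance v1 w1 sub_wv A2.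
  by have := noB B; rewrite B2 dB !eqxx.
have s2 (A : {set 'I_m}) : #|A| = 2%N -> #|s A| = 2%N by case/sP.
have s_dot (A : {set 'I_m}) : #|A| = 2%N -> dot v (s A) = dot w A by case/sP.
pose D := [set A : {set 'I_m} | #|A| == 2%N]%SET.
have s_inj (A B : {set 'I_m}) : #|A| = 2%N -> #|B| = 2%N -> s A = s B -> A = B.
  (* [s] maps the edges onto the edges: an edge B has the distance in [v] of
     some edge A in [w], and then [s A] = B by separation. *)
  have /imset_injP inj : #|[set s A | A in D]%SET| == #|D|.
    rewrite eqn_leq leq_imset_card subset_leq_card //.
    apply/subsetP => C; rewrite inE => /eqP C2.
    have [E E2 dE] := dot_of_distance w1 v1 sub_vw C2.
    apply/imsetP; exists E; first by rewrite inE E2.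
    by apply: dot_inj; rewrite ?s2 // s_dot.
  by move=> A2 B2; apply: inj; rewrite inE ?A2 ?B2.
have s_sing : singular_on_colorings R n.+2 s.
  move=> h c h_inj; have pair2 a b : a != b -> #|[set h a; h b]%SET| = 2%N.
    by move=> ab; rewrite cards2 (inj_eq h_inj) ab.
  pose t : {ffun 'I_n.+3 * 'I_n.+3 -> {set 'I_m}} :=
    [ffun ab => s [set h ab.1; h ab.2]%SET].
  have := degen t _ c.
  have -> : unit_diag_mx (fun a b => dot v (t (a, b))) =
      \matrix_(a, b) \sum_k w (h a) k 0 * w (h b) k 0.
    apply/matrixP => a b; rewrite !mxE ffunE /=.
    have [<-|ab] := eqVneq a b; last first.
      by rewrite s_dot ?pair2 // dot2 // (inj_eq h_inj).
    by have /unit_sphereP <- := w1 (h a); apply: eq_bigr => k _; rewrite expr2.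
  rewrite gram_det0 // => /(_ erefl) <-.
  congr (\det _); apply/matrixP => a b; rewrite !mxE ffunE /=.
  have [//|ab] := eqVneq a b; rewrite dot_basis //.
  by rewrite -card_gt0 s2 // pair2.
have [p p_inj sE] := edge_map_from_vertex_map lt_nm s_sing s2 s_inj.
pose V := \matrix_(k, i) v (p i) k 0; pose W := \matrix_(k, i) w i k 0.
have VW : V^T *m V = W^T *m W.
  apply/matrixP => i j; rewrite !mxE.
  under eq_bigr do rewrite !mxE; under [RHS]eq_bigr do rewrite !mxE.
  have [<-|ij] := eqVneq i j.
    have /unit_sphereP := v1 (p i); have /unit_sphereP := w1 i.
    by rewrite /sqnorm => <-.
  by rewrite -dot2 ?(inj_eq p_inj) // -dot2 // -sE // s_dot // cards2 ij.
have V_free : row_free V.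
  apply: inj_row_free => u uV0.
  have uv0 j : \sum_k u 0 k * v j k 0 = 0.
    have /matrixP/(_ 0 (invF p_inj j)) := uV0; rewrite !mxE => sum0.
    rewrite -[RHS]sum0.
    by apply: eq_bigr => k _; rewrite mxE f_invF.
  pose F := \matrix_(i, k) v (f i) k 0.
  have uF0 : u *m F^T = 0.
    apply/matrixP => i j; rewrite !mxE ord1 -[RHS](uv0 (f j)).
    by apply: eq_bigr => k _; rewrite !mxE.
  have F_unit : F^T \in unitmx by rewrite unitmx_tr unitmxE unitfE.
  by rewrite -[u](mulmxK F_unit) uF0 mul0mx.
have [g g_orth Wg] := gram_eq_orthogonal V_free VW.
exists g => //.
have wE i : w i = g *m v (p i).
  apply/colP => k; have /matrixP/(_ k i) := Wg; rewrite !mxE => ->.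
  by apply: eq_bigr => l _; rewrite mxE.
apply/seteqP; split => x [i _ <-].
  by exists (p i) => //; rewrite wE.
by exists (invF p_inj i) => //; rewrite wE f_invF.
Qed.

(** Colour one vertex of B outside A differently from all the others: then A is
    monochromatic and B is not. *)
Lemma dot_separates_pairs (R : realType) (m n : nat) (A B : {set 'I_m}) :
    #|A| = 2%N -> #|B| = 2%N -> A != B ->
  generic_poly (dot_poly R n.+2 A - dot_poly R n.+2 B).
Proof.
move=> A2 B2 AB.
have [b Bb bA] : exists2 b, b \in B & b \notin A.
  by apply/subsetPn; apply: contraNN AB => BA; rewrite eq_sym eqEcard BA A2 B2.
have [b' Bb' bb'] : exists2 b', b' \in B & b' != b.
  have /card_gt1P[x [y [Bx By xy]]] : (1 < #|B|)%N by rewrite B2.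
  by have [xb|] := eqVneq x b; [exists y; rewrite // -xb eq_sym | exists x].
pose c x : 'I_n.+2 := if x == b then 1 else 0.
apply: (generic_at_basis (c := c)).
rewrite mevalB !dot_polyE !dot_basis -?card_gt0 ?A2 ?B2 //.
have -> : monochromatic c A.
  apply/monochromaticP => x y Ax Ay; rewrite /c !ifN //.
    by apply: contraNneq bA => <-.
  by apply: contraNneq bA => <-.
have -> : monochromatic c B = false.
  apply/monochromaticP => /(_ b b' Bb Bb').
  by rewrite /c eqxx (negPf bb').
by rewrite subr0 oner_neq0.
Qed.

(** Give n of the points the n different colours: the matrix is the identity. *)
Lemma frame_poly_generic (R : realType) (m n : nat) (f : 'I_n.+1 -> 'I_m) :
  injective f -> generic_poly (frame_poly R f).
Proof.
move=> f_inj; pose c x : 'I_n.+1 := odflt 0 [pick i | f i == x].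
have cf i : c (f i) = i.
  rewrite /c; case: pickP => [j /eqP /f_inj //|/(_ i)]; by rewrite eqxx.
apply: (generic_at_basis (c := c)); rewrite frame_polyE.
suff -> : \matrix_(i, k) basis_config R c (f i) k 0 = 1%:M.
  by rewrite det1 oner_neq0.
by apply/matrixP => i k; rewrite !mxE cf andbT eq_sym.
Qed.

Theorem corollary1 (R : realType) (m n : nat) (hn : (2 <= n)%N)
    (hmn : (n < m)%N) :
  exists U : set ('I_m -> 'cV[R]_n),
    [/\ zariski_open_in (@sphere_configs R m n) U,
        U !=set0
      & forall v : 'I_m -> 'cV[R]_n, U v ->
        forall w : 'I_m -> 'cV[R]_n,
          (forall i : 'I_m, unit_sphere (w i)) ->
          unlabeled_distances w = unlabeled_distances v ->
          exists2 g : 'M[R]_n, orthogonal_mx g &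
            range w = range (fun i : 'I_m => g *m v i)].
Proof.
case: n hn hmn => [|[|n]] // _ hmn.
pose f : 'I_n.+2 -> 'I_m := widen_ord (ltnW hmn).
have f_inj : injective f by move=> i j /(congr1 val) /= ?; apply: val_inj.
pose minors := \prod_(t : {ffun 'I_n.+3 * 'I_n.+3 -> {set 'I_m}})
  generic_factor (minor_poly R n.+2 t).
pose differences := \prod_(AB : {set 'I_m} * {set 'I_m})
  generic_factor (dot_poly R n.+2 AB.1 - dot_poly R n.+2 AB.2).
pose P := minors * differences * frame_poly R f.
have [z z_neq0 Pz] : generic_poly P.
  apply: generic_polyM (frame_poly_generic _ f_inj).
  by apply: generic_polyM; apply: generic_factor_prod.
exists (@sphere_configs R m n.+2 `\` [set v | P.@[coords v] = 0]); split.
- exists [set v | P.@[coords v] = 0] => //; exists [set P].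
  by apply/seteqP; split => v /= Pv => [p ->|]; [exact: Pv | exact: Pv].
- exists (fun i => line_reflection (z i)); split; last exact/eqP.
  by move=> i; apply/unit_sphereP/line_reflection_sqnorm.
move=> v [v1 /eqP]; rewrite !mevalM !mulf_eq0 !negb_or frame_polyE.
move=> /andP[/andP[minors_v differences_v] frame_v] w w1.
apply: (determined_by_distances hmn v1 w1 _ _ frame_v).
- move=> t det_v c; apply/eqP/negPn/negP => det_c.
  have t_gen : generic_poly (minor_poly R n.+2 t).
    by apply: (generic_at_basis (c := c)); rewrite minor_polyE.
  have := generic_factor_eval minors_v t_gen.
  by rewrite minor_polyE det_v eqxx.
- move=> A B A2 B2 dAB; apply/eqP/negPn/negP => nAB.
  have AB_gen := dot_separates_pairs R n A2 B2 nAB.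
  have := generic_factor_eval (i := (A, B)) differences_v AB_gen.
  by rewrite mevalB !dot_polyE dAB subrr eqxx.
Qed.
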